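(* Let $k$ be a field. Every special quasi-biserial $k$-algebra $A=kQ/I$ is a quotient of a symmetric special quasi-biserial $k$-algebra; that is, there exist a symmetric special quasi-biserial $k$-algebra $A_s$ and a surjective $k$-algebra homomorphism $A_s\to A$.
   Context: Quivers $Q$ are finite, with vertex set $Q_0$ and arrow set $Q_1$; $s(p)$ and $t(p)$ denote source and target of a path $p$; paths are written from right to left, so $p=\alpha_n\cdots\alpha_1$ starts with the arrow $\alpha_1$. An ideal $I$ of $kQ$ is admissible if $\langle Q_1\rangle^m\subseteq I\subseteq\langle Q_1\rangle^2$ for some $m\ge 2$. Let $Q$ be a quiver such that at every vertex at most two arrows start and at most two arrows end. An arrow $\alpha$ of $Q$ is called non-single if there is another arrow $\beta\ne\alpha$ with $s(\beta)=s(\alpha)$ or $t(\beta)=t(\alpha)$; otherwise $\alpha$ is called single. Special quasi-biserial algebra: a $k$-algebra Morita equivalent to some $kQ/I$ with $I$ admissible such that (1) at every vertex of $Q$ at most two arrows start and at most two arrows end; (2) for each path $p$ in $Q$ containing at least one non-single arrow, there is at most one arrow $\beta$ with $\beta p\notin I$ and at most one arrow $\gamma$ with $p\gamma\notin I$. A finite-dimensional $k$-algebra $A$ is symmetric if there is a $k$-linear map $\psi:A\to k$ with $\psi(xy)=\psi(yx)$ for all $x,y\in A$ and such that $\psi(xy)=0$ for all $y\in A$ implies $x=0$. *)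

(* Defs.v *)
From HB Require Import structures.
From mathcomp Require Import all_boot all_order all_algebra all_field.
From mathcomp Require Import finmap.
From mathcomp.multinomials Require Import monalg.

Set Implicit Arguments.
Unset Strict Implicit.
Unset Printing Implicit Defensive.

Import GRing.Theory.
Local Open Scope fset_scope.
Local Open Scope ring_scope.

Record quiver : Type := Quiver {
  vertex : finType;
  arrow : finType;
  src : arrow -> vertex;
  tgt : arrow -> vertex }.

Section Paths.
Variable Q : quiver.

Fixpoint composable (v : vertex Q) (s : seq (arrow Q)) : bool :=
  if s is a :: s' then (src a == v) && composable (tgt a) s' else true.

(* The pair (v, [:: a_1; ...; a_n]) encodes the path a_n ... a_1 starting at
   v; n = 0 gives the trivial path at v. *)
Record qpath : Type := QPath {
  qpath_val :> vertex Q * seq (arrow Q);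
  _ : composable qpath_val.1 qpath_val.2 }.

HB.instance Definition _ := [isSub for qpath_val].
HB.instance Definition _ := [Choice of qpath by <:].

Definition psrc (p : qpath) : vertex Q := (val p).1.
Definition parrows (p : qpath) : seq (arrow Q) := (val p).2.
Definition ptgt (p : qpath) : vertex Q := last (psrc p) (map (@tgt Q) (parrows p)).

Definition ptriv (v : vertex Q) : qpath := @QPath (v, [::]) isT.

Lemma composable1 (a : arrow Q) : composable (src a) [:: a].
Proof. by rewrite /= eqxx. Qed.

Definition parrow (a : arrow Q) : qpath := @QPath (src a, [:: a]) (composable1 a).

(* The composite q p (first p, then q), which exists iff s(q) = t(p). *)
Definition path_comp (q p : qpath) : option qpath :=
  if psrc q == ptgt p then insub (psrc p, parrows p ++ parrows q) else None.

Lemma composable_cat v s1 s2 :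
  composable v (s1 ++ s2) =
  composable v s1 && composable (last v (map (@tgt Q) s1)) s2.
Proof. by elim: s1 v => //= a s IH v; rewrite IH andbA. Qed.

Variant path_comp_spec (q p : qpath) : option qpath -> Type :=
  | PcompSome r of psrc q = ptgt p & psrc r = psrc p & ptgt r = ptgt q
      & parrows r = parrows p ++ parrows q : path_comp_spec q p (Some r)
  | PcompNone of psrc q <> ptgt p : path_comp_spec q p None.

Lemma path_compP q p : path_comp_spec q p (path_comp q p).
Proof.
rewrite /path_comp; case: eqP => [e|e]; last by constructor.
case: insubP => [r _ er|].
  constructor => //; rewrite /ptgt /psrc /parrows er //=.
  by rewrite map_cat last_cat -/(parrows p) -/(psrc p) -/(ptgt p) -e.
by rewrite /= composable_cat -/(ptgt p) -e (valP p) (valP q).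
Qed.

Lemma qpath_eq (p q : qpath) : psrc p = psrc q -> parrows p = parrows q -> p = q.
Proof.
case: p q => [[v s] i] [[w t] j] e1 e2; apply/val_inj.
by congr pair.
Qed.

Lemma path_compA p q r :
  obind (fun u => path_comp u r) (path_comp p q) = obind (path_comp p) (path_comp q r).
Proof.
case: path_compP => [u e1 e2 e3 e4|n1]; case: path_compP => [w f1 f2 f3 f4|n2] //=.
- case: path_compP => [x g1 g2 g3 g4|n]; last by case: n; rewrite e2.
  case: path_compP => [y h1 h2 h3 h4|n]; last by case: n; rewrite f3.
  by congr Some; apply: qpath_eq; rewrite ?g2 ?h2 ?f2 // g4 h4 e4 f4 catA.
- by case: path_compP => // x g1; case: n2; rewrite -e2.
by case: path_compP => // x g1; case: n1; rewrite g1 f3.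
Qed.

Lemma path_comp1p v p : path_comp (ptriv v) p = if v == ptgt p then Some p else None.
Proof.
case: path_compP => [r e1 e2 e3 e4|/eqP/negPf e]; last by rewrite [v == _]e.
rewrite [v == _](introT eqP e1); congr Some.
by apply: qpath_eq => //; rewrite e4 cats0.
Qed.

Lemma path_compp1 v p : path_comp p (ptriv v) = if v == psrc p then Some p else None.
Proof.
case: path_compP => [r e1 e2 e3 e4|/eqP/negPf e].
  rewrite [v == _]eq_sym [_ == v](introT eqP e1); congr Some.
  by apply: qpath_eq => //; rewrite e2 e1.
by rewrite eq_sym [_ == v]e.
Qed.

End Paths.

(* Locked: unification must not unfold these sums. *)
HB.lock Definition pathE (k : fieldType) (Q : quiver) (p : qpath Q)
  : {malg k[qpath Q]} := << p >>.
Arguments pathE k {Q} p.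

Definition pathM (k : fieldType) (Q : quiver) (q p : qpath Q)
  : {malg k[qpath Q]} := oapp (pathE k) 0 (path_comp q p).

HB.lock Definition kq_mul (k : fieldType) (Q : quiver) (x y : {malg k[qpath Q]})
  : {malg k[qpath Q]} :=
  \sum_(q <- msupp x) \sum_(p <- msupp y) (x@_q * y@_p) *: pathM k q p.

Section PathAlgebra.
Variables (k : fieldType) (Q : quiver).
Local Notation kQ := {malg k[qpath Q]}.
Local Notation pathE := (@pathE k Q).
Local Notation pathM := (@pathM k Q).
Local Notation kq_mul := (@kq_mul k Q).
Implicit Types (x y z : kQ) (p q r : qpath Q).

Definition kq_one : kQ := \sum_(v : vertex Q) pathE (ptriv v).

Lemma kq_mulE (d1 d2 : {fset qpath Q}) x y :
  msupp x `<=` d1 -> msupp y `<=` d2 ->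
  kq_mul x y = \sum_(q <- d1) \sum_(p <- d2) (x@_q * y@_p) *: pathM q p.
Proof.
move=> s1 s2; rewrite kq_mul.unlock (big_fset_incl _ s1) /=.
  apply: eq_bigr => q _; apply: big_fset_incl => // p _ /mcoeff_outdom ->.
  by rewrite mulr0 scale0r.
move=> q _ /mcoeff_outdom e.
by rewrite big1 // => p _; rewrite e mul0r scale0r.
Qed.

Lemma kq_mulDl : left_distributive kq_mul +%R.
Proof.
move=> x y z; pose d := msupp x `|` msupp y.
rewrite (kq_mulE (d1 := d) (msuppD_le _ _) (fsubset_refl _)).
rewrite (kq_mulE (d1 := d) (fsubsetUl _ _) (fsubset_refl _)).
rewrite (kq_mulE (d1 := d) (fsubsetUr _ _) (fsubset_refl (msupp z))).
rewrite -big_split; apply: eq_bigr => q _; rewrite -big_split; apply: eq_bigr => p _.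
by rewrite /= mcoeffD mulrDl scalerDl.
Qed.

Lemma kq_mulDr : right_distributive kq_mul +%R.
Proof.
move=> z x y; pose d := msupp x `|` msupp y.
rewrite (kq_mulE (d2 := d) (fsubset_refl _) (msuppD_le _ _)).
rewrite (kq_mulE (d2 := d) (fsubset_refl _) (fsubsetUl _ _)).
rewrite (kq_mulE (d2 := d) (fsubset_refl (msupp z)) (fsubsetUr _ _)).
rewrite -big_split; apply: eq_bigr => q _; rewrite -big_split; apply: eq_bigr => p _.
by rewrite /= mcoeffD mulrDr scalerDl.
Qed.

Lemma kq_mulZl c x y : kq_mul (c *: x) y = c *: kq_mul x y.
Proof.
rewrite (kq_mulE (d1 := msupp x) (msuppZ_le _ _) (fsubset_refl _)).
rewrite [in RHS]kq_mul.unlock scaler_sumr.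
apply: eq_bigr => q _; rewrite scaler_sumr; apply: eq_bigr => p _.
by rewrite mcoeffZ scalerA mulrA.
Qed.

Lemma kq_mulZr c x y : kq_mul x (c *: y) = c *: kq_mul x y.
Proof.
rewrite (kq_mulE (d2 := msupp y) (fsubset_refl _) (msuppZ_le _ _)).
rewrite [in RHS]kq_mul.unlock scaler_sumr.
apply: eq_bigr => q _; rewrite scaler_sumr; apply: eq_bigr => p _.
by rewrite mcoeffZ scalerA mulrCA.
Qed.

Lemma kq_mul0l x : kq_mul 0 x = 0.
Proof. by have := kq_mulZl 0 0 x; rewrite !scale0r. Qed.

Lemma kq_mul0r x : kq_mul x 0 = 0.
Proof. by have := kq_mulZr 0 x 0; rewrite !scale0r. Qed.

Lemma kq_mul_suml I (s : seq I) (F : I -> kQ) y :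
  kq_mul (\sum_(i <- s) F i) y = \sum_(i <- s) kq_mul (F i) y.
Proof. exact: (big_morph (kq_mul^~ y) (fun a b => kq_mulDl a b y) (kq_mul0l y)). Qed.

Lemma kq_mul_sumr I (s : seq I) (F : I -> kQ) y :
  kq_mul y (\sum_(i <- s) F i) = \sum_(i <- s) kq_mul y (F i).
Proof. exact: (big_morph (kq_mul y) (kq_mulDr y) (kq_mul0r y)). Qed.

Lemma kq_mul_path q p : kq_mul (pathE q) (pathE p) = pathM q p.
Proof.
have su r : msupp (pathE r) `<=` [fset r] by rewrite pathE.unlock msuppU_le.
have cu r : (pathE r)@_r = 1 by rewrite pathE.unlock mcoeffUU.
by rewrite (kq_mulE (su q) (su p)) !big_seq_fset1 !cu mulr1 scale1r.
Qed.

Lemma kq_expand x : x = \sum_(p <- msupp x) x@_p *: pathE p.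
Proof.
rewrite [LHS]monalgE; apply: eq_bigr => p _; apply/malgP => r.
apply: etrans (esym (mcoeffZ _ _ _)).
by rewrite pathE.unlock; apply: etrans (mcoeffU _ _ _) _; rewrite mcoeffU mulrnAr mulr1.
Qed.

Lemma kq_mul_path3 p q r :
  kq_mul (pathE p) (kq_mul (pathE q) (pathE r)) =
  kq_mul (kq_mul (pathE p) (pathE q)) (pathE r).
Proof.
rewrite !kq_mul_path /pathM; have := path_compA p q r.
case: (path_comp p q) => [u|]; case: (path_comp q r) => [w|] /= e.
- by rewrite !kq_mul_path /pathM e.
- by rewrite kq_mul_path /pathM e kq_mul0r.
- by rewrite kq_mul_path /pathM -e kq_mul0l.
- by rewrite kq_mul0r kq_mul0l.
Qed.

Lemma kq_mulA : associative kq_mul.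
Proof.
move=> x y z; rewrite (kq_expand x) !kq_mul_suml; apply: eq_bigr => p _.
rewrite !kq_mulZl; congr (_ *: _).
rewrite (kq_expand y) kq_mul_suml !kq_mul_sumr kq_mul_suml.
apply: eq_bigr => q _; rewrite (kq_mulZl _ (pathE q) z).
apply: etrans (kq_mulZr _ _ _) _.
apply: etrans _ (esym (congr1 (kq_mul^~ z) (kq_mulZr _ _ _))).
apply: etrans _ (esym (kq_mulZl _ _ _)); congr (_ *: _).
rewrite (kq_expand z) !kq_mul_sumr; apply: eq_bigr => r _.
by rewrite !kq_mulZr kq_mul_path3.
Qed.

Lemma kq_mul1l : left_id kq_one kq_mul.
Proof.
move=> x; rewrite [in RHS](kq_expand x) {1}(kq_expand x) kq_mul_sumr.
apply: eq_bigr => p _; rewrite kq_mulZr; congr (_ *: _).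
rewrite kq_mul_suml (bigD1 (ptgt p)) //= big1 ?addr0 => [|v /negPf nv].
  by rewrite kq_mul_path /pathM path_comp1p eqxx.
by rewrite kq_mul_path /pathM path_comp1p nv.
Qed.

Lemma kq_mul1r : right_id kq_one kq_mul.
Proof.
move=> x; rewrite [in RHS](kq_expand x) {1}(kq_expand x) kq_mul_suml.
apply: eq_bigr => p _; rewrite kq_mulZl; congr (_ *: _).
rewrite kq_mul_sumr (bigD1 (psrc p)) //= big1 ?addr0 => [|v /negPf nv].
  by rewrite kq_mul_path /pathM path_compp1 eqxx.
by rewrite kq_mul_path /pathM path_compp1 nv.
Qed.

End PathAlgebra.

Definition path_algebra (k : fieldType) (Q : quiver) : Type := {malg k[qpath Q]}.

HB.instance Definition _ k Q := GRing.Lmodule.on (path_algebra k Q).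

(* Only a pzRing: kQ is the zero ring when Q has no vertices. *)
HB.instance Definition _ k Q := GRing.Zmodule_isPzRing.Build (path_algebra k Q)
  (@kq_mulA k Q) (@kq_mul1l k Q) (@kq_mul1r k Q) (@kq_mulDl k Q) (@kq_mulDr k Q).

Definition path_elt (k : fieldType) (Q : quiver) (p : qpath Q) : path_algebra k Q :=
  @pathE k Q p.
Arguments path_elt k {Q} p.

Section Ideals.
Variable R : pzRingType.
Implicit Types I J : R -> Prop.

Definition ideal I : Prop :=
  [/\ I 0, forall x y, I x -> I y -> I (x + y)
    & forall a x, I x -> I (a * x) /\ I (x * a)].

Definition ideal_gen (S : R -> Prop) : R -> Prop :=
  fun x => forall I, ideal I -> (forall s, S s -> I s) -> I x.

Definition ideal_mul I J : R -> Prop :=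
  fun x => exists (n : nat) (a b : 'I_n -> R),
    [/\ forall i, I (a i), forall i, J (b i) & x = \sum_(i < n) a i * b i].

Fixpoint ideal_exp I (n : nat) : R -> Prop :=
  if n is n'.+1 then ideal_mul I (ideal_exp I n') else fun _ => True.

End Ideals.

Section SpecialQuasiBiserial.
Variables (k : fieldType) (Q : quiver).
Local Notation kQ := (path_algebra k Q).
Implicit Type I : kQ -> Prop.

Definition arrow_ideal : kQ -> Prop :=
  ideal_gen (fun x => exists a : arrow Q, x = path_elt k (parrow a)).

Definition admissible I : Prop :=
  ideal I /\
  exists2 m : nat, (2 <= m)%N &
    (forall x, ideal_exp arrow_ideal m x -> I x) /\
    (forall x, I x -> ideal_exp arrow_ideal 2 x).

Definition at_most_two_arrows : Prop :=
  forall v : vertex Q,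
    (#|[set a : arrow Q | src a == v]| <= 2)%N /\
    (#|[set a : arrow Q | tgt a == v]| <= 2)%N.

Definition non_single (a : arrow Q) : Prop :=
  exists b : arrow Q, b <> a /\ (src b = src a \/ tgt b = tgt a).

Definition contains_non_single (p : qpath Q) : Prop :=
  exists2 a : arrow Q, a \in parrows p & non_single a.

(* Products of non-composable paths are 0 in kQ, hence lie in I. *)
Definition unique_extensions I : Prop :=
  forall p : qpath Q, contains_non_single p ->
    (forall b b' : arrow Q,
       ~ I (path_elt k (parrow b) * path_elt k p) ->
       ~ I (path_elt k (parrow b') * path_elt k p) -> b = b') /\
    (forall c c' : arrow Q,
       ~ I (path_elt k p * path_elt k (parrow c)) ->
       ~ I (path_elt k p * path_elt k (parrow c')) -> c = c').

Definition special_quasi_biserial_pair I : Prop :=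
  [/\ admissible I, at_most_two_arrows & unique_extensions I].

(* A is (isomorphic to) kQ/I. *)
Definition is_path_quotient I (A : algType k) : Prop :=
  exists pi : {linear kQ -> A},
    [/\ monoid_morphism pi, forall a : A, exists x : kQ, pi x = a
      & forall x : kQ, pi x = 0 <-> I x].

End SpecialQuasiBiserial.

Section Morita.
Variable k : fieldType.

(* k-linear functors between categories of left modules. Morphisms are
   compared pointwise, since Leibniz equality of {linear M -> N} is not
   extensional. The scalar c : k acts on an A-module through c%:A. *)
Record mod_functor (A B : algType k) := ModFunctor {
  fobj :> lmodType A -> lmodType B;
  fmor : forall M N : lmodType A, {linear M -> N} -> {linear fobj M -> fobj N};
  fmor_ext : forall (M N : lmodType A) (f g : {linear M -> N}),
    f =1 g -> fmor f =1 fmor g;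
  fmor_id : forall M : lmodType A, fmor (idfun : {linear M -> M}) =1 idfun;
  fmor_comp : forall (M N P : lmodType A) (g : {linear N -> P})
      (f : {linear M -> N}),
    fmor (g \o f : {linear M -> P}) =1 fmor g \o fmor f;
  fmor_linear : forall (M N : lmodType A) (c : k) (f g h : {linear M -> N}),
    (forall x, h x = c%:A *: f x + g x) ->
    forall x, fmor h x = c%:A *: fmor f x + fmor g x }.

Definition morita_equivalent (A B : algType k) : Prop :=
  exists (F : mod_functor A B) (G : mod_functor B A)
         (eta : forall M : lmodType A, {linear M -> G (F M)})
         (eps : forall N : lmodType B, {linear F (G N) -> N}),
    [/\ forall M, bijective (eta M),
        forall (M M' : lmodType A) (f : {linear M -> M'}),
          eta M' \o f =1 fmor G (fmor F f) \o eta M,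
        forall N, bijective (eps N)
      & forall (N N' : lmodType B) (g : {linear N -> N'}),
          g \o eps N =1 eps N' \o fmor F (fmor G g)].

Definition special_quasi_biserial (A : algType k) : Prop :=
  exists (Q : quiver) (I : path_algebra k Q -> Prop) (B : algType k),
    [/\ special_quasi_biserial_pair I, is_path_quotient I B
      & morita_equivalent A B].

(* falgType k is the type of finite-dimensional k-algebras. *)
Definition symmetric_algebra (A : falgType k) : Prop :=
  exists psi : {scalar A},
    (forall x y : A, psi (x * y) = psi (y * x)) /\
    (forall x : A, (forall y : A, psi (x * y) = 0) -> x = 0).

End Morita.

(* Main.v *)
From HB Require Import structures.
Require Import Defs.
From mathcomp Require Import all_boot all_order all_algebra all_field.
From mathcomp Require Import finmap boolp.
From mathcomp.multinomials Require Import monalg.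

Set Implicit Arguments.
Unset Strict Implicit.
Unset Printing Implicit Defensive.

Import GRing.Theory.
Local Open Scope fset_scope.
Local Open Scope ring_scope.

(** Why the theorem is true.  Think of a quiver Q' in which exactly two lanes
    run through every vertex, so that the lanes are the pairs (v, i) of a vertex
    and a bit, together with a permutation [next] of the lanes that moves each
    lane along an arrow [label x]; every arrow is to be used.  Following a lane x
    for d steps spells a path [seg S x d].  An arrow used by two different lanes
    is necessarily single ([non_single_label]): the two lanes then fill both its
    source and its target, and no room is left for a further arrow.

    Such a lane system yields a symmetric algebra.  Let N be a multiple of the
    order of [next], and let [trace] be the linear form on kQ' which is 1 on the
    full turns [seg S x N] and 0 on every other path.  Rotating a full turn gives
    a full turn, so [trace (u * w) = trace (w * u)], and the radical
    [trace_radical] of the bilinear form [trace (u * w)] is a two-sided ideal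
    with a symmetric quotient.  A path that is not a segment of a lane lies in
    the radical, so a path p through a non-single arrow, which knows its lane,
    has at most one extension on each side outside the radical.  Conversely, an
    element of the radical has coefficient 0 at every short segment
    ([radical_coeff]): completing the segment to a full turn leaves at least a
    whole period, which determines all the labels of the lane and thus separates
    the segment from every other path.  Hence the radical is admissible.

    It remains to find, for the given pair (Q, I), a quiver Q' obtained by adding
    arrows to Q and a lane system on it along which all paths outside I run
    ([lane_completion]).  A non-single arrow takes up one lane at its source and
    one at its target, whereas a single arrow carries both lanes and keeps their
    bits.  The bits at the targets of non-single arrows are chosen freely, subject
    to arrows with a common target getting different bits; the bit of a non-single
    arrow b at its source is forced whenever b P c is not in I for some non-single
    arrow c and some path P of single arrows, and the uniqueness of extensions
    says precisely that these constraints are consistent ([linked_inj],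
    [linked_src_inj]).  This gives a partial injection of the lanes, which is
    completed to a permutation; each lane that had no arrow to leave by gets a new
    one.

    Finally the homomorphism [collapse] from kQ' to A kills the new arrows.  For N
    large it kills the radical: the short segments have coefficient 0 there, and
    all other paths of Q' are sent to 0 because they contain a new arrow or lie
    in I.  So A is a quotient of the symmetric algebra kQ' / [trace_radical]. *)

(** * Linear maps out of a path algebra *)

Section LinearExtension.
Variables (k : fieldType) (Q : quiver) (V : lmodType k).
Local Notation kQ := (path_algebra k Q).

Definition lin_ext (f : qpath Q -> V) (x : kQ) : V :=
  \sum_(p <- msupp x) x@_p *: f p.

Variable f : qpath Q -> V.

Lemma lin_extE (d : {fset qpath Q}) (x : kQ) :
  msupp x `<=` d -> lin_ext f x = \sum_(p <- d) x@_p *: f p.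
Proof.
move=> sxd; apply: big_fset_incl => // p _ /mcoeff_outdom ->.
by rewrite scale0r.
Qed.

Lemma lin_ext_is_linear : linear (lin_ext f).
Proof.
move=> c x y; pose d := msupp x `|` msupp y.
have sx : msupp x `<=` d by apply: fsubsetUl.
have sy : msupp y `<=` d by apply: fsubsetUr.
have sz : msupp (c *: x + y) `<=` d.
  apply: fsubset_trans (msuppD_le _ _) _.
  by rewrite fsubUset sy (fsubset_trans (msuppZ_le _ _) sx).
rewrite (lin_extE sx) (lin_extE sy) (lin_extE sz) scaler_sumr -big_split.
apply: eq_bigr => p _ /=.
by rewrite mcoeffD mcoeffZ scalerDl scalerA.
Qed.

HB.instance Definition _ :=
  GRing.isLinear.Build k kQ V *:%R (lin_ext f) lin_ext_is_linear.

Lemma lin_ext_path p : lin_ext f (path_elt k p) = f p.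
Proof.
have su : msupp (path_elt k p) `<=` [fset p].
  by rewrite /path_elt pathE.unlock msuppU_le.
rewrite (lin_extE su) big_seq_fset1.
by rewrite /path_elt pathE.unlock mcoeffUU scale1r.
Qed.

End LinearExtension.

Section PathAlgebraTheory.
Variables (k : fieldType) (Q : quiver).
Local Notation kQ := (path_algebra k Q).
Local Notation elt := (@path_elt k Q).
Implicit Types (x y : kQ) (p q : qpath Q).

Lemma path_algebra_expand x : x = \sum_(p <- msupp x) x@_p *: elt p.
Proof. exact: kq_expand. Qed.

Lemma path_algebra_ind (P : kQ -> Prop) :
  P 0 -> (forall c x y, P x -> P y -> P (c *: x + y)) ->
  (forall p, P (elt p)) -> forall x, P x.
Proof.
move=> P0 PD Pp x; rewrite (path_algebra_expand x).
by elim/big_rec: _ => // p y _; apply: PD.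
Qed.

Lemma path_algebra_scalerAl c x y : c *: (x * y) = (c *: x) * y.
Proof. by rewrite [RHS]kq_mulZl. Qed.

Lemma path_algebra_scalerAr c x y : c *: (x * y) = x * (c *: y).
Proof. by rewrite [RHS]kq_mulZr. Qed.

Lemma path_eltM q p : elt q * elt p = oapp elt 0 (path_comp q p).
Proof. exact: kq_mul_path. Qed.

Lemma mcoeff_path p q : (elt p : {malg k[qpath Q]})@_q = (p == q)%:R.
Proof. by rewrite /path_elt pathE.unlock mcoeffU. Qed.

Lemma path_algebra1 : 1 = \sum_(v : vertex Q) elt (ptriv v).
Proof. by []. Qed.

End PathAlgebraTheory.

(** * Finite-dimensional quotients of a path algebra *)

Section QuotientAlgebra.
Variables (k : fieldType) (Q : quiver).
Local Notation kQ := (path_algebra k Q).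

(** The domain has infinite dimension, so the image has to be found inside V: it
    is spanned by any finite family of values whose span has maximal dimension. *)
Lemma linear_image_vspace (V : vectType k) (f : {linear kQ -> V}) :
  exists U : {vspace V}, forall v, v \in U <-> exists x, f x = v.
Proof.
pose P n := `[< exists s : seq kQ, \dim <<map f s>>%VS = n >].
have exP : exists n, P n by exists (\dim <<map f [::]>>%VS); apply/asboolP; exists [::].
have leP n : P n -> (n <= \dim {:V})%N.
  by move=> /asboolP[s <-]; apply/dimvS/subvf.
case: (ex_maxnP exP leP) => n /asboolP[s es] maxn.
exists <<map f s>>%VS => v; split=> [|[x <-]].
  elim: s v {es maxn} => [|x s IH] v.
    by rewrite span_nil memv0 => /eqP->; exists 0; rewrite linear0.
  rewrite span_cons => /memv_addP[u /vlineP[c ->] [w /IH[y <-] ->]].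
  by exists (c *: x + y); rewrite linearP.
have sub : (<<map f s>> <= <<map f (x :: s)>>)%VS by rewrite span_cons addvSr.
have e : (<<map f s>> == <<map f (x :: s)>>)%VS.
  rewrite eqEdim sub es; apply: maxn; apply/asboolP; by exists (x :: s).
by rewrite (eqP e); apply: memv_span; rewrite mem_head.
Qed.

(** The section [rep] of [pi] is what makes the product of two classes a function
    of the classes. *)
Record quotient_data (W : vectType k) (pi : {linear kQ -> W}) (rep : W -> kQ)
    : Prop := QuotientData {
  quot_repK : cancel rep pi;
  quot_kerl : forall a x, pi x = 0 -> pi (a * x) = 0;
  quot_kerr : forall a x, pi x = 0 -> pi (x * a) = 0;
  quot_1 : pi 1 != 0 }.

(** The space W under a name of its own, on which the quotient ring structure can
    be declared; it depends on the proof of [quotient_data]. *)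
Definition quot_algebra W pi rep of @quotient_data W pi rep : Type := W.

Section Structure.
Variables (W : vectType k) (pi : {linear kQ -> W}) (rep : W -> kQ).
Variable h : quotient_data pi rep.
Local Notation B := (quot_algebra h).

HB.instance Definition _ := Vector.on B.

Definition quot_mul (u v : B) : B := pi (rep u * rep v).

(** Independence of the representatives: this is where the kernel has to absorb
    products on both sides.  All ring axioms are then inherited through [pi]. *)
Lemma quot_mulE x y : quot_mul (pi x) (pi y) = pi (x * y).
Proof.
have dif z : pi (rep (pi z) - z) = 0 by rewrite linearB (quot_repK h) subrr.
apply/eqP; rewrite -subr_eq0 -linearB.
have -> : rep (pi x) * rep (pi y) - x * y
   = (rep (pi x) - x) * rep (pi y) + x * (rep (pi y) - y).
  by rewrite mulrBl mulrBr addrA subrK.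
by rewrite linearD (quot_kerr h) // (quot_kerl h) // addr0.
Qed.

Let ex (u : B) : pi (rep u) = u. Proof. exact: quot_repK h u. Qed.

Lemma quot_mulA : associative quot_mul.
Proof.
by move=> u v w; rewrite -(ex u) -(ex v) -(ex w) !quot_mulE mulrA.
Qed.

Lemma quot_mul1 : left_id (pi 1 : B) quot_mul.
Proof. by move=> u; rewrite -(ex u) quot_mulE mul1r. Qed.

Lemma quot_mulr1 : right_id (pi 1 : B) quot_mul.
Proof. by move=> u; rewrite -(ex u) quot_mulE mulr1. Qed.

Lemma quot_mulDl : left_distributive quot_mul +%R.
Proof.
move=> u v w; rewrite -(ex u) -(ex v) -(ex w) !quot_mulE.
by rewrite -[_ + _ in LHS](linearD pi) quot_mulE mulrDl linearD.
Qed.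

Lemma quot_mulDr : right_distributive quot_mul +%R.
Proof.
move=> u v w; rewrite -(ex u) -(ex v) -(ex w) !quot_mulE.
by rewrite -[_ + _ in LHS](linearD pi) quot_mulE mulrDr linearD.
Qed.

HB.instance Definition _ := GRing.Zmodule_isNzRing.Build B
  quot_mulA quot_mul1 quot_mulr1 quot_mulDl quot_mulDr (quot_1 h).

Lemma quot_scalerAl (c : k) (u v : B) : c *: (u * v) = (c *: u) * v.
Proof.
rewrite -(ex u) -(ex v) /GRing.mul /= !quot_mulE.
by rewrite -[c *: pi _ in RHS](linearZ_LR pi) quot_mulE -path_algebra_scalerAl linearZ_LR.
Qed.

Lemma quot_scalerAr (c : k) (u v : B) : c *: (u * v) = u * (c *: v).
Proof.
rewrite -(ex u) -(ex v) /GRing.mul /= !quot_mulE.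
by rewrite -[c *: pi _ in RHS](linearZ_LR pi) quot_mulE -path_algebra_scalerAr linearZ_LR.
Qed.

HB.instance Definition _ := GRing.Lmodule_isLalgebra.Build k B quot_scalerAl.
HB.instance Definition _ := GRing.Lalgebra_isAlgebra.Build k B quot_scalerAr.
HB.instance Definition _ := Algebra_isFalgebra.Build k B.

End Structure.

(** The image of f, as a vector space, is the quotient by the kernel; choosing a
    preimage of each of its vectors turns it into the quotient algebra. *)
Lemma finite_dim_quotient (V : vectType k) (f : {linear kQ -> V}) :
  (forall a x, f x = 0 -> f (a * x) = 0 /\ f (x * a) = 0) -> f 1 != 0 ->
  exists (B : falgType k) (pi : {linear kQ -> B}),
    [/\ monoid_morphism pi, forall b, exists x, pi x = b
      & forall x, pi x = 0 <-> f x = 0].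
Proof.
move=> fI f1; have [U imU] := linear_image_vspace f.
have fU x : f x \in U by apply/imU; exists x.
pose g x : subvs_of U := vsproj U (f x).
have g_lin : linear g by move=> c x y; rewrite /g !linearP.
pose gL := GRing.isLinear.Build k kQ (subvs_of U) *:%R g g_lin.
pose pi : {linear kQ -> subvs_of U} := HB.pack g gL.
have piE x : vsval (pi x) = f x by rewrite vsprojK.
have pi0 x : pi x = 0 <-> f x = 0.
  split=> e; first by rewrite -piE e linear0.
  by apply: val_inj; rewrite /= piE e.
have /choice[rep repK] : forall w : subvs_of U, exists x, pi x = w.
  move=> w; have /imU[x ex] := subvsP w.
  by exists x; apply: val_inj; rewrite /= piE.
have h : quotient_data pi rep.
  split=> [//|a x /pi0/(fI a)[e _]|a x /pi0/(fI a)[_ e]|]; try exact/pi0.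
  by apply: contra_neq f1 => /pi0.
exists (quot_algebra h), (pi : {linear kQ -> quot_algebra h}); split=> //.
  by split=> // x y; exact: esym (quot_mulE h x y).
by move=> b; exists (rep b).
Qed.

End QuotientAlgebra.

(** * Path length and powers of the arrow ideal *)

Section Degree.
Variables (k : fieldType) (Q : quiver).
Local Notation kQ := (path_algebra k Q).
Local Notation elt := (@path_elt k Q).
Implicit Types (x y : kQ) (p q : qpath Q) (n m : nat).

Definition plen p := size (parrows p).

Definition deg_ge n x := forall p, (plen p < n)%N -> x@_p = 0.

Lemma deg_ge0 n : deg_ge n 0. Proof. by move=> p _; rewrite mcoeff0. Qed.

Lemma deg_geD n x y : deg_ge n x -> deg_ge n y -> deg_ge n (x + y).
Proof. by move=> hx hy p lp; rewrite mcoeffD hx // hy // addr0. Qed.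

Lemma deg_geZ n c x : deg_ge n x -> deg_ge n (c *: x).
Proof. by move=> hx p lp; rewrite mcoeffZ hx // mulr0. Qed.

Lemma deg_ge_sum n (J : eqType) (r : seq J) (F : J -> kQ) :
  (forall i, i \in r -> deg_ge n (F i)) -> deg_ge n (\sum_(i <- r) F i).
Proof.
move=> hF; rewrite big_seq; elim/big_rec: _ => [|i x ir dx]; first exact: deg_ge0.
by apply: deg_geD (hF _ ir) dx.
Qed.

Lemma deg_ge_path n p : (n <= plen p)%N -> deg_ge n (elt p).
Proof.
move=> np q lq; rewrite mcoeff_path; case: eqP => // e.
by move: lq; rewrite -e ltnNge np.
Qed.

Lemma plen_supp n x p : deg_ge n x -> p \in msupp x -> (n <= plen p)%N.
Proof. by move=> hx; rewrite -mcoeff_neq0 leqNgt; apply: contraNN => /hx->. Qed.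

Lemma deg_geM n m x y : deg_ge n x -> deg_ge m y -> deg_ge (n + m) (x * y).
Proof.
move=> hx hy; rewrite (path_algebra_expand x) mulr_suml.
apply: deg_ge_sum => q /(plen_supp hx) nq.
rewrite (path_algebra_expand y) mulr_sumr; apply: deg_ge_sum => p /(plen_supp hy) mp.
rewrite -path_algebra_scalerAl -path_algebra_scalerAr path_eltM; do 2!apply: deg_geZ.
case: path_compP => [r _ _ _ er|_]; last exact: deg_ge0.
by apply: deg_ge_path; rewrite /plen er size_cat addnC leq_add.
Qed.

Lemma deg_ge_ideal n : ideal (deg_ge n : kQ -> Prop).
Proof.
split; [exact: deg_ge0|by move=> x y; apply: deg_geD|move=> a x hx].
have h0 : deg_ge 0 a by [].
by split; [have := deg_geM h0 hx|have := deg_geM hx h0; rewrite addn0].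
Qed.

Lemma arrow_ideal_exp_deg n x : ideal_exp (@arrow_ideal k Q) n x -> deg_ge n x.
Proof.
elim: n x => [//|n IH] x [m [a [b [ha hb ->]]]].
apply: deg_ge_sum => i _; apply: (@deg_geM 1 n); last exact: IH (hb i).
apply: ha; first exact: deg_ge_ideal.
by move=> _ [c ->]; apply: deg_ge_path.
Qed.

(** Lets one check on long paths alone that a linear map vanishes on a power of the
    arrow ideal. *)
Lemma linear_deg_ge0 (V : lmodType k) (f : {linear kQ -> V}) n x :
  deg_ge n x -> (forall p, (n <= plen p)%N -> f (elt p) = 0) -> f x = 0.
Proof.
move=> hx hf; rewrite (path_algebra_expand x) linear_sum big_seq big1 // => p px.
by rewrite linearZ_LR hf ?scaler0 // (plen_supp hx).
Qed.

Lemma arrow_ideal_ideal : ideal (@arrow_ideal k Q).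
Proof.
split=> [J [] //|x y hx hy J iJ hJ|a x hx].
  by have [_ D _] := iJ; apply: D; [apply: hx|apply: hy].
by split=> J iJ hJ; have [_ _ M] := iJ; case: (M a x (hx J iJ hJ)).
Qed.

Lemma arrow_ideal_arrow a : arrow_ideal (elt (parrow a)).
Proof. by move=> J _; apply; exists a. Qed.

Lemma path_elt_rcons v s b (h : composable v (rcons s b)) :
  exists h' : composable v s,
    elt (@QPath Q (v, rcons s b) h) = elt (parrow b) * elt (@QPath Q (v, s) h').
Proof.
have [h' sb] : composable v s /\ src b = last v (map (@tgt Q) s).
  by move: h; rewrite -cats1 composable_cat /= andbT => /andP[? /eqP].
exists h'; rewrite path_eltM; case: path_compP => [r _ e1 _ e2|] //=.
by congr (elt _); apply: qpath_eq; rewrite ?e1 ?e2 /psrc /parrows //= cats1.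
Qed.

Lemma path_split_last p : (0 < plen p)%N ->
  exists b q, elt p = elt (parrow b) * elt q /\ plen p = (plen q).+1.
Proof.
case: p => [[v s] h]; rewrite /plen /parrows /= in h *.
case/lastP: s h => // s b h _; have [h' e] := path_elt_rcons h.
by exists b, (@QPath Q (v, s) h'); rewrite e size_rcons.
Qed.

(** A path with at least n + 1 arrows is its last arrow times a path with at least
    n arrows, so the sum over the support is itself of the shape required in the
    recursive definition of the powers. *)
Lemma deg_arrow_ideal_exp n x : deg_ge n x -> ideal_exp (@arrow_ideal k Q) n x.
Proof.
elim: n x => // n IH x hx; pose s : seq (qpath Q) := msupp x.
have /choice[F hF] : forall i : 'I_(size s), exists u : kQ * kQ,
    [/\ arrow_ideal u.1, ideal_exp (@arrow_ideal k Q) n u.2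
      & x@_(tnth (in_tuple s) i) *: elt (tnth (in_tuple s) i) = u.1 * u.2].
  move=> i; set p := tnth _ _.
  have /(plen_supp hx) np : p \in msupp x by apply: mem_tnth.
  have [b [q [-> eq]]] := path_split_last (leq_trans (ltn0Sn n) np).
  exists (x@_p *: elt (parrow b), elt q); split=> /=.
  - have [_ _ M] := arrow_ideal_ideal.
    have := M (x@_p *: (1 : kQ)) _ (arrow_ideal_arrow b).
    by rewrite -path_algebra_scalerAl mul1r => -[].
  - by apply: IH; apply: deg_ge_path; rewrite -ltnS -eq.
  - by rewrite path_algebra_scalerAl.
exists (size s), (fun i => (F i).1), (fun i => (F i).2); split.
- by move=> i; case: (hF i).
- by move=> i; case: (hF i).
rewrite {1}(path_algebra_expand x) big_tnth; apply: eq_bigr => i _.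
by case: (hF i).
Qed.

End Degree.

(** * Lane systems and their symmetric algebras *)

Definition lane (Q : quiver) : finType := (vertex Q * bool)%type.

(** Since every arrow is a label and there are two lanes at each vertex, Q has at
    most two arrows starting, and at most two ending, at any vertex.  Two lanes may
    share an arrow. *)
Record lane_system (Q : quiver) := LaneSystem {
  next : lane Q -> lane Q;
  label : lane Q -> arrow Q;
  next_inj : injective next;
  src_label : forall x, src (label x) = x.1;
  tgt_label : forall x, tgt (label x) = (next x).1;
  label_surj : forall a, exists x, label x = a }.
Arguments next_inj {Q} l {x1 x2} _.

Section LaneSystem.
Variables (k : fieldType) (Q : quiver) (S : lane_system Q).
Local Notation kQ := (path_algebra k Q).
Local Notation elt := (@path_elt k Q).
Local Notation lane := (lane Q).
Local Notation next := (next S).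
Local Notation label := (label S).

Variables L N : nat.
Hypothesis period_gt0 : (0 < L)%N.
Hypothesis iter_period : forall x, iter L next x = x.
Hypothesis ltLN : (L < N)%N.
Hypothesis iter_N : forall x, iter N next x = x.
Implicit Types (x y z : lane) (p q r : qpath Q) (d e n m : nat).

Definition walk x d : seq (arrow Q) := [seq label y | y <- traject next x d].

Lemma walk_composable x d : composable x.1 (walk x d).
Proof. by elim: d x => //= d IH x; rewrite (src_label S) eqxx (tgt_label S) IH. Qed.

Definition seg x d : qpath Q := @QPath Q (x.1, walk x d) (walk_composable x d).

Lemma plen_seg x d : plen (seg x d) = d.
Proof. by rewrite /plen size_map size_traject. Qed.

Lemma walk_cat x d e : walk x (d + e) = walk x d ++ walk (iter d next x) e.
Proof. by rewrite /walk trajectD map_cat. Qed.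

Lemma ptgt_seg x d : ptgt (seg x d) = (iter d next x).1.
Proof.
rewrite /ptgt /psrc /parrows /=; elim: d x => //= d IH x.
by rewrite (tgt_label S) IH -iterSr.
Qed.

Lemma seg_comp x d e :
  path_comp (seg (iter d next x) e) (seg x d) = Some (seg x (d + e)).
Proof.
case: path_compP => [r _ e1 _ e2|]; last by rewrite ptgt_seg.
by congr Some; apply: qpath_eq => //; rewrite e2 /parrows /= walk_cat.
Qed.

Lemma seg_split q p x n : path_comp q p = Some (seg x n) ->
  [/\ p = seg x (plen p), q = seg (iter (plen p) next x) (plen q)
    & (plen p + plen q)%N = n].
Proof.
case: path_compP => // r e1 e2 e3 e4 [er].
have en : (plen p + plen q)%N = n by rewrite -size_cat -e4 er; apply: plen_seg.
have ep : p = seg x (plen p).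
  apply: qpath_eq; first by rewrite -e2 er.
  have := congr1 (take (plen p)) e4; rewrite take_size_cat // => <-.
  by rewrite er -en /parrows /= walk_cat take_size_cat // size_map size_traject.
split=> //; apply: qpath_eq; first by rewrite e1 {1}ep ptgt_seg.
have := congr1 (drop (plen p)) e4; rewrite drop_size_cat // => <-.
by rewrite er -en /parrows /= walk_cat drop_size_cat // size_map size_traject.
Qed.

Lemma nth_walk a x d i : (i < d)%N -> nth a (walk x d) i = label (iter i next x).
Proof.
by move=> lt; rewrite (nth_map x) ?size_traject // nth_traject.
Qed.

Lemma iter_modL i x : iter i next x = iter (i %% L)%N next x.
Proof.
rewrite {1}(divn_eq i L) iterD; move: (iter (i %% L)%N next x) => y.
by elim: (i %/ L)%N => // m IH; rewrite mulSn iterD IH iter_period.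
Qed.

(** A segment that covers a whole period spells all the labels of its lane.  The
    lanes x and y need not be equal: two lanes that always carry the same arrows
    are indistinguishable by paths, but they also define the same paths. *)
Lemma seg_period x y n : (L <= n)%N -> seg x n = seg y n ->
  forall m d, seg (iter m next x) d = seg (iter m next y) d.
Proof.
move=> Ln e.
have el i : label (iter i next x) = label (iter i next y).
  rewrite iter_modL (iter_modL i y).
  have lti : (i %% L < n)%N by apply: leq_trans (ltn_pmod _ _) Ln.
  rewrite -(nth_walk (label x) x lti) -(nth_walk (label x) y lti).
  by rewrite -[walk x n]/(parrows (seg x n)) e.
move=> m d; apply: qpath_eq.
  by rewrite /psrc /= -!(src_label S) el.
apply: (@eq_from_nth _ (label x)); rewrite ?plen_seg //.
  by rewrite -!/(plen _) !plen_seg.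
move=> i; rewrite -/(plen _) plen_seg => lt; rewrite !nth_walk //.
by rewrite -!iterD el.
Qed.

(** N is a common multiple of the cycle lengths of [next], so these paths go round
    their lanes a whole number of times and all have the same length. *)
Definition trace_path p : k^o := [exists x, p == seg x N]%:R.

Definition trace : kQ -> k^o := lin_ext trace_path.
HB.instance Definition _ := GRing.Linear.on trace.

Lemma trace_elt p : trace (elt p) = trace_path p.
Proof. exact: lin_ext_path. Qed.

Lemma trace_comp q p :
  trace (elt q * elt p) = [exists x, path_comp q p == Some (seg x N)]%:R.
Proof.
rewrite path_eltM; case: path_comp => [r|] /=; first by rewrite trace_elt.
by rewrite linear0; case: existsP => // -[].
Qed.

(** If q p is the full turn starting on the lane z, then p q is the full turn
    starting on the lane reached from z after p. *)
Lemma trace_comm (u w : kQ) : trace (u * w) = trace (w * u).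
Proof.
elim/path_algebra_ind: u => [|c u v hu hv|q]; first by rewrite mul0r mulr0.
  rewrite mulrDl mulrDr -path_algebra_scalerAl -path_algebra_scalerAr.
  by rewrite !linearP /= hu hv.
elim/path_algebra_ind: w => [|c u v hu hv|p]; first by rewrite mul0r mulr0.
  rewrite mulrDl mulrDr -path_algebra_scalerAl -path_algebra_scalerAr.
  by rewrite !linearP /= hu hv.
suff H q' p' : [exists x, path_comp q' p' == Some (seg x N)] ->
    [exists x, path_comp p' q' == Some (seg x N)].
  by rewrite !trace_comp; congr (nat_of_bool _)%:R; apply/idP/idP; apply: H.
move=> /existsP[z /eqP/seg_split[]].
move: (plen p') (plen q') => d e -> -> eN; apply/existsP; exists (iter d next z).
by rewrite -{1}(iter_N z) -eN addnC iterD seg_comp.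
Qed.

Definition trace_radical (u : kQ) : Prop := forall w, trace (u * w) = 0.

Lemma trace_radical_mul (a u : kQ) :
  trace_radical u -> trace_radical (a * u) /\ trace_radical (u * a).
Proof.
move=> hu; split=> w; last by rewrite -mulrA hu.
by rewrite -mulrA trace_comm -mulrA hu.
Qed.

Lemma trace_radical_ideal : ideal trace_radical.
Proof.
split; last exact: trace_radical_mul.
  by move=> w; rewrite mul0r linear0.
by move=> u v hu hv w; rewrite mulrDl linearD /= hu hv addr0.
Qed.

(** Finitely many test elements suffice, because the left factor of a full turn
    and the right one are segments.  This is what makes the quotient
    finite-dimensional. *)
Lemma trace_radical_paths (u : kQ) :
  (forall x d, (d <= N)%N -> trace (u * elt (seg x d)) = 0) -> trace_radical u.
Proof.
move=> hu; elim/path_algebra_ind => [|c y z hy hz|p].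
- by rewrite mulr0 linear0.
- by rewrite mulrDr -path_algebra_scalerAr linearP /= hy hz scaler0 addr0.
have [[x ep]|np] := pselect (exists x, p = seg x (plen p)); last first.
  elim/path_algebra_ind: u {hu} => [|c y z hy hz|q].
  - by rewrite mul0r linear0.
  - by rewrite mulrDl -path_algebra_scalerAl linearP /= hy hz scaler0 addr0.
  rewrite trace_comp; case: existsP => // -[x /eqP/seg_split[ep _ _]].
  by case: np; exists x.
have [le|gt] := leqP (plen p) N; first by rewrite ep hu.
elim/path_algebra_ind: u {hu} => [|c y z hy hz|q].
- by rewrite mul0r linear0.
- by rewrite mulrDl -path_algebra_scalerAl linearP /= hy hz scaler0 addr0.
rewrite trace_comp; case: existsP => // -[z /eqP/seg_split[_ _ e]].
by move: gt; rewrite -e ltnNge leq_addr.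
Qed.

Lemma not_radical_seg p : ~ trace_radical (elt p) -> exists x, p = seg x (plen p).
Proof.
move=> hp; apply: contrapT => np; apply: hp.
apply: trace_radical_paths => y d _.
rewrite trace_comp; case: existsP => // -[z /eqP/seg_split[_ e _]].
by case: np; eexists; exact: e.
Qed.

Lemma long_radical p : (N < plen p)%N -> trace_radical (elt p).
Proof.
move=> lp; apply: trace_radical_paths => y d _.
rewrite trace_comp; case: existsP => // -[z /eqP/seg_split[_ _ e]].
by move: lp; rewrite -e ltnNge leq_addl.
Qed.

(** The complement of [seg S z d] in a full turn has length N - d, at least a period.
    Whenever q times this complement is a full turn, the complement determines the
    labels of q, so that q is [seg S z d].  So multiplying by the
    complement and taking the trace reads off a single coefficient. *)
Lemma trace_coeff (u : kQ) z d : (d + L <= N)%N ->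
  trace (u * elt (seg (iter d next z) (N - d))) = u@_(seg z d).
Proof.
move=> dLN; have dN : (d <= N)%N by apply: leq_trans dLN; apply: leq_addr.
elim/path_algebra_ind: u => [|c u v hu hv|q].
- by rewrite mul0r linear0 mcoeff0.
- by rewrite mulrDl -path_algebra_scalerAl linearP /= hu hv mcoeffD mcoeffZ.
rewrite trace_comp mcoeff_path; congr (nat_of_bool _)%:R.
apply/existsP/eqP => [[x /eqP/seg_split]|->].
  rewrite plen_seg => -[e1 e2 e3].
  (* x and the lane reached from z after d steps spell the same N - d >= L labels *)
  have Ld : (L <= N - d)%N by rewrite leq_subRL // addnC.
  rewrite e2 -(seg_period Ld e1) -iterD subnK // iter_N.
  by congr (seg _ _); apply/eqP; rewrite -(eqn_add2l (N - d)) e3 subnK.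
exists (iter d next z); apply/eqP.
rewrite -{1}(iter_N z) -{1}(subnK dN) iterD seg_comp subnK //.
Qed.

Lemma radical_coeff (u : kQ) z d :
  trace_radical u -> (d + L <= N)%N -> u@_(seg z d) = 0.
Proof. by move=> hu /(trace_coeff u z) <-; apply: hu. Qed.

(** Both lanes run through every vertex and every arrow is a label; this is what
    keeps the radical inside the square of the arrow ideal. *)
Lemma short_seg p : (plen p < 2)%N -> exists x, p = seg x (plen p).
Proof.
case: p => [[v [|a [|b s]]]] //= h _.
  by exists (v, true); apply: qpath_eq.
have [x ex] := (label_surj S) a; have /andP[/eqP sa _] := h.
exists x; apply: qpath_eq; rewrite /psrc /parrows /=; first by rewrite -(src_label S) ex.
by rewrite /plen /walk /= ex.
Qed.

Lemma trace_radical_admissible : admissible trace_radical.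
Proof.
split; first exact: trace_radical_ideal.
exists N.+1; first by rewrite ltnS (leq_trans period_gt0) // ltnW.
split=> u hu.
  move=> y; move/arrow_ideal_exp_deg: hu => hu.
  have hf : linear (fun v : kQ => trace (v * y)).
    by move=> c v w; rewrite mulrDl -path_algebra_scalerAl linearP.
  pose fL := GRing.isLinear.Build k kQ k^o *:%R _ hf.
  pose f : {linear kQ -> k^o} := HB.pack (fun v : kQ => trace (v * y)) fL.
  by apply: (linear_deg_ge0 (f := f) hu) => p lp; apply: long_radical.
apply: (@deg_arrow_ideal_exp _ _ 2) => p p2; have [x ->] := short_seg p2.
apply: radical_coeff => //; apply: leq_trans ltLN.
by rewrite -add1n leq_add2r.
Qed.

Lemma lane_dichotomy x y z : x <> y -> x.1 = y.1 -> z.1 = x.1 -> z = x \/ z = y.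
Proof.
case: x y z => [v i] [w j] [u l] /= nxy ew eu; subst w u.
by case: i j l nxy => -[] [] // nxy; by [left|right].
Qed.

(** If two lanes share the arrow [label x], they are the two lanes at its source and
    are carried to the two lanes at its target, so no other arrow starts or ends
    there. *)
Lemma non_single_label x y : non_single (label x) -> label x = label y -> x = y.
Proof.
move=> [b [nb hb]] exy; apply: contrapT => nxy; apply: nb.
have [z ez] := (label_surj S) b; rewrite -ez in hb *.
case: hb => [|] e.
  rewrite !(src_label S) in e; have e1 : x.1 = y.1 by rewrite -!(src_label S) exy.
  by case: (lane_dichotomy nxy e1 e) => ->.
rewrite !(tgt_label S) in e; have e1 : (next x).1 = (next y).1 by rewrite -!(tgt_label S) exy.
have nxy' : next x <> next y by move=> /(next_inj S).
by case: (lane_dichotomy nxy' e1 e) => /(next_inj S) ->.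
Qed.

Lemma lane_at_most_two : at_most_two_arrows Q.
Proof.
move=> v; split.
  apply: leq_trans (_ : #|[set label (v, true); label (v, false)]| <= 2)%N; last first.
    by rewrite cards2; case: eqP.
  apply/subset_leq_card/subsetP => a; rewrite !inE.
  have [[w b] <-] := (label_surj S) a; rewrite (src_label S) /= => /eqP->.
  by case: b; rewrite eqxx ?orbT.
have [prev prevK] : exists prev, cancel next prev.
  by exists (iter L.-1 next) => x; rewrite -iterSr prednK.
apply: leq_trans (_ : #|[set label (prev (v, true)); label (prev (v, false))]| <= 2)%N.
  apply/subset_leq_card/subsetP => a; rewrite !inE.
  have [z <-] := (label_surj S) a; rewrite (tgt_label S) => /eqP <-.
  rewrite -{1 3}(prevK z); case: (next z) => w b /=.
  by case: b; rewrite eqxx ?orbT.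
by rewrite cards2; case: eqP.
Qed.

(** The position of a non-single arrow in p fixes the lane at that position, hence,
    [next] being injective, the lane at the start of p. *)
Lemma seg_non_single p x y : contains_non_single p ->
  p = seg x (plen p) -> p = seg y (plen p) -> x = y.
Proof.
move=> [a ap na] ex ey; pose i := index a (parrows p).
have lti : (i < plen p)%N by rewrite index_mem.
have hl z : p = seg z (plen p) -> label (iter i next z) = a.
  move=> ez; rewrite -(nth_walk a z lti) -[walk _ _]/(parrows (seg z (plen p))).
  by rewrite -ez nth_index.
have e : iter i next x = iter i next y.
  by apply: non_single_label; rewrite ?hl.
elim: i e {hl lti} => //= i IH /(next_inj S); exact: IH.
Qed.

Lemma lane_unique_extensions : unique_extensions trace_radical.
Proof.
have H q p : ~ trace_radical (elt q * elt p) ->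
    exists x, p = seg x (plen p) /\ q = seg (iter (plen p) next x) (plen q).
  rewrite path_eltM; case e : (path_comp q p) => [r|] /=; last first.
    by case; case: trace_radical_ideal.
  move=> /not_radical_seg[x er]; move: e; rewrite er => /seg_split[e1 e2 _].
  by exists x.
move=> p np; split=> [b b'|c c'].
  move=> /H[x [ex ebx]] /H[y [ey eby]].
  have exy := seg_non_single np ex ey; subst y.
  have /(congr1 (fun r => parrows r)) : parrow b = parrow b' by rewrite ebx eby.
  by case.
move=> /H[x [ex ecx]] /H[y [ey ecy]].
have /(next_inj S) exy := seg_non_single np ecx ecy; subst y.
have /(congr1 (fun r => parrows r)) : parrow c = parrow c' by rewrite ex ey.
by case.
Qed.

Lemma lane_special_quasi_biserial : special_quasi_biserial_pair trace_radical.
Proof.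
split; [exact: trace_radical_admissible|exact: lane_at_most_two|].
exact: lane_unique_extensions.
Qed.

(** The trace descends to the quotient by its radical, where it is nondegenerate by
    construction. *)
Lemma lane_symmetric_algebra : inhabited (vertex Q) ->
  exists (B : falgType k) (pi : {linear kQ -> B}),
    [/\ monoid_morphism pi, forall b, exists u, pi u = b,
        forall u, pi u = 0 <-> trace_radical u & symmetric_algebra B].
Proof.
move=> [v].
pose g (u : kQ) : {ffun lane * 'I_N.+1 -> k^o} :=
  [ffun j : lane * 'I_N.+1 => trace (u * elt (seg j.1 j.2))].
have g_lin : linear g.
  move=> c u w; apply/ffunP => j.
  by rewrite !ffunE mulrDl -path_algebra_scalerAl linearP.
pose gL := GRing.isLinear.Build k kQ {ffun lane * 'I_N.+1 -> k^o} *:%R g g_lin.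
pose f : {linear kQ -> {ffun lane * 'I_N.+1 -> k^o}} := HB.pack g gL.
have f0 u : f u = 0 <-> trace_radical u.
  split=> [e|hu]; last by apply/ffunP => j; rewrite !ffunE hu.
  apply: trace_radical_paths => x d dN; rewrite -ltnS in dN.
  by have := congr1 (fun h => fun_of_fin h (x, Ordinal dN)) e; rewrite !ffunE.
have fI a u : f u = 0 -> f (a * u) = 0 /\ f (u * a) = 0.
  by move=> /f0/(trace_radical_mul a)[h1 h2]; split; apply/f0.
have f1 : f 1 != 0.
  apply/eqP=> /f0 h; have := h (elt (seg (v, true) N)).
  rewrite mul1r trace_elt /trace_path.
  by case: existsP => [_ /eqP|[]]; [rewrite oner_eq0|exists (v, true)].
have [B [pi [pi_mor pi_surj pi_ker]]] := finite_dim_quotient fI f1.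
have ker u : pi u = 0 <-> trace_radical u.
  by split=> [/pi_ker/f0|/f0/pi_ker].
exists B, pi; split=> //.
have /choice[rep repK] := pi_surj.
have trE u : trace (rep (pi u)) = trace u.
  apply/eqP; rewrite -subr_eq0 -linearB; apply/eqP.
  have /ker/(_ 1) : pi (rep (pi u) - u) = 0 by rewrite linearB repK subrr.
  by rewrite mulr1.
have [pi1 piM] := pi_mor.
pose t (b : B) : k^o := trace (rep b).
have t_lin : scalar t.
  move=> c b1 b2; rewrite /t -{1}(repK b1) -{1}(repK b2) -linearP trE.
  by rewrite linearP.
pose tL := GRing.isLinear.Build k B k *%R t t_lin.
pose psi : {scalar B} := HB.pack t tL.
exists psi; split=> [b1 b2|b hb] /=.
  by rewrite /t -(repK b1) -(repK b2) -!piM !trE trace_comm.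
rewrite -(repK b); apply/ker => u.
by rewrite -[LHS]trE piM repK; apply: hb.
Qed.

End LaneSystem.

(** * Homomorphisms out of a path algebra *)

Section PathAlgebraLift.
Variables (k : fieldType) (Q : quiver) (A : algType k).
Variables (E : vertex Q -> A) (F : arrow Q -> A).
Hypothesis E_orth : forall v w, E v * E w = if v == w then E v else 0.
Hypothesis E_sum : \sum_v E v = 1.
Hypothesis F_tgt : forall a, E (tgt a) * F a = F a.
Local Notation kQ := (path_algebra k Q).
Local Notation elt := (@path_elt k Q).

Definition path_val (p : qpath Q) : A :=
  foldl (fun b a => F a * b) (E (psrc p)) (parrows p).

Definition path_lift : kQ -> A := lin_ext path_val.
HB.instance Definition _ := GRing.Linear.on path_lift.

Lemma foldl_arrow_mulr b c s :
  foldl (fun b a => F a * b) c s * b = foldl (fun b a => F a * b) (c * b) s.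
Proof. by elim: s c => //= a s IH c; rewrite IH mulrA. Qed.

Lemma path_val_src p : path_val p * E (psrc p) = path_val p.
Proof. by rewrite /path_val foldl_arrow_mulr E_orth eqxx. Qed.

Lemma path_val_tgt p : E (ptgt p) * path_val p = path_val p.
Proof.
suff H v b s : E v * b = b ->
    E (last v (map (@tgt Q) s)) * foldl (fun b a => F a * b) b s
    = foldl (fun b a => F a * b) b s.
  by apply: H; rewrite E_orth eqxx.
by elim: s v b => //= a s IH v b _; apply: IH; rewrite mulrA F_tgt.
Qed.

Lemma path_lift_elt p : path_lift (elt p) = path_val p.
Proof. exact: lin_ext_path. Qed.

Lemma path_liftM x y : path_lift (x * y) = path_lift x * path_lift y.
Proof.
elim/path_algebra_ind: x => [|c u v hu hv|q]; first by rewrite mul0r linear0 mul0r.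
  by rewrite mulrDl -path_algebra_scalerAl !linearP /= hu hv mulrDl scalerAl.
elim/path_algebra_ind: y => [|c u v hu hv|p]; first by rewrite mulr0 linear0 mulr0.
  by rewrite mulrDr -path_algebra_scalerAr !linearP /= hu hv mulrDr scalerAr.
rewrite path_eltM !path_lift_elt.
case: path_compP => [r e1 e2 _ e3|/eqP/negPf ne] /=.
  rewrite path_lift_elt /path_val foldl_arrow_mulr -/(path_val p) e1 path_val_tgt.
  by rewrite e3 foldl_cat e2.
rewrite linear0 -(path_val_src q) -(path_val_tgt p) mulrA -(mulrA (path_val q)).
rewrite E_orth ne.
by rewrite mulr0 mul0r.
Qed.

Lemma path_lift1 : path_lift 1 = 1.
Proof.
rewrite path_algebra1 linear_sum -E_sum; apply: eq_bigr => v _.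
by rewrite /= path_lift_elt.
Qed.

End PathAlgebraLift.

(** * Completing partial colourings and partial injections *)

Section TwoColouring.
Variables (T V : finType) (f : T -> V).
Hypothesis fibre2 : forall v, (#|[set a | f a == v]| <= 2)%N.

Lemma fibre2_dichotomy a b c : f a = f b -> f c = f a -> a != b -> (c == a) || (c == b).
Proof.
move=> eab eca nab; apply: contraTT (fibre2 (f a)) => /norP[nca ncb].
rewrite -ltnNge; apply: (@leq_trans #|[set a; b; c]|).
  by rewrite -setUA !cardsU1 cards1 !inE negb_or nab eq_sym nca eq_sym ncb.
apply/subset_leq_card/subsetP => z; rewrite !inE.
by case/orP=> [/orP[]|] /eqP->; rewrite ?eqxx // -?eab ?eca eqxx.
Qed.

(** Given a partial colouring h that is injective on the fibres of f: an uncoloured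
    element with a coloured neighbour in its fibre takes the other colour, and a
    fibre without colours is coloured by marking one element of it. *)
Lemma extend_two_colouring (h : T -> option bool) :
  (forall a b c, f a = f b -> h a = Some c -> h b = Some c -> a = b) ->
  exists g : T -> bool, (forall a b, f a = f b -> g a = g b -> a = b) /\
    forall a c, h a = Some c -> g a = c.
Proof.
move=> hP; pose g0 a := [pick b | f b == f a] == Some a.
have g0P a b : f a = f b -> g0 a = g0 b -> a = b.
  move=> eab; rewrite /g0 eab; case: pickP => [c /eqP ec|/(_ b)]; last by rewrite eqxx.
  case: eqP => [[<-]|nca]; case: eqP => [[<-]|ncb] // _.
  apply/eqP; apply: contraT => nab.
  have := fibre2_dichotomy eab (etrans ec (esym eab)) nab.
  by case/orP=> /eqP e; [case: nca|case: ncb]; rewrite e.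
pose g a := if h a is Some c then c else
  if [pick b | (f b == f a) && (h b != None)] is Some b then ~~ odflt true (h b)
  else g0 a.
exists g; split=> [a b eab|a c ha]; last by rewrite /g ha.
have none a' b' : f a' = f b' -> h a' = None -> h b' <> None -> g a' = ~~ g b'.
  move=> eab' ha' hb'; rewrite /g ha'; case: pickP => [c /andP[/eqP ec hc]|/(_ b')].
    have nab : a' != b' by apply: contra_notN hb' => /eqP <-.
    have := fibre2_dichotomy eab' ec nab.
    case/orP => /eqP e; first by rewrite e ha' in hc.
    by rewrite e; case: (h b') hb'.
  by rewrite -eab' eqxx; case: (h b') hb'.
case ha: (h a) => [c|]; case hb: (h b) => [d|].
- by rewrite /g ha hb => e; apply: (hP a b c); rewrite // hb e.
- by rewrite (none b a) ?ha //; case: (g a).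
- by rewrite (none a b) ?hb //; case: (g b).
rewrite /g ha hb -eab; case: pickP => [c /andP[/eqP ec hc] _|_]; last exact: g0P.
apply/eqP; apply: contraT => nab.
by have := fibre2_dichotomy eab ec nab => /orP[] /eqP e; rewrite e ?ha ?hb in hc.
Qed.

End TwoColouring.

(** The values of f on D, followed by the remaining elements, list the whole type;
    s matches this list with D followed by its complement. *)
Lemma extend_injection (T : finType) (D : {set T}) (f : T -> T) :
  {in D &, injective f} ->
  exists s : T -> T, injective s /\ {in D, s =1 f}.
Proof.
move=> fD; pose s1 := enum D ++ enum (~: D).
pose s2 := [seq f x | x <- enum D] ++ enum (~: (f @: D)).
have s1T x : x \in s1 by rewrite mem_cat !mem_enum inE orbN.
have u1 : uniq s1.
  rewrite cat_uniq !enum_uniq andbT; apply/hasPn => x.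
  by rewrite !mem_enum inE.
have u2 : uniq s2.
  rewrite cat_uniq enum_uniq andbT map_inj_in_uniq ?enum_uniq /=; last first.
    by move=> x y; rewrite !mem_enum; apply: fD.
  apply/hasPn => x; rewrite mem_enum inE; apply: contraNN => /mapP[y yD ->].
  by rewrite imset_f // -mem_enum.
have es : size s1 = size s2.
  rewrite !size_cat size_map -!cardE; have := cardsC D; have := cardsC (f @: D).
  by rewrite card_in_imset // => -> .
exists (fun x => nth x s2 (index x s1)); split=> [x y|x xD].
  have lx : (index x s1 < size s2)%N by rewrite -es index_mem.
  have ly : (index y s1 < size s2)%N by rewrite -es index_mem.
  rewrite (set_nth_default x y) // => /eqP; rewrite nth_uniq // => /eqP e.
  by rewrite -(nth_index x (s1T x)) e nth_index.
have xe : x \in enum D by rewrite mem_enum.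
rewrite index_cat xe nth_cat size_map index_mem xe.
by rewrite (nth_map x) ?index_mem // nth_index.
Qed.

Lemma injection_period (T : finType) (s : T -> T) : injective s ->
  exists2 L, (0 < L)%N & forall x, iter L s x = x.
Proof.
move=> s_inj; exists (#|T|)`!; first exact: fact_gt0.
move=> x; have /dvdnP[m ->] : (fingraph.order s x %| (#|T|)`!)%N.
  by apply: dvdn_fact; rewrite fingraph.order_gt0 max_card.
elim: m => // m IH; by rewrite mulSn iterD IH fingraph.iter_order.
Qed.

(** * Lanes carrying all the paths outside an ideal *)

Section LanesOfPair.
Variables (k : fieldType) (Q : quiver) (I : path_algebra k Q -> Prop).
Hypothesis hI : special_quasi_biserial_pair I.
Local Notation kQ := (path_algebra k Q).
Local Notation elt := (@path_elt k Q).
Local Notation lane := (lane Q).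
Implicit Types (a b c : arrow Q) (s t P : seq (arrow Q)) (i j : bool).

Definition nsingle a : bool :=
  [exists b, (b != a) && ((src b == src a) || (tgt b == tgt a))].

Lemma nsingleP a : nsingle a -> non_single a.
Proof.
case/existsP=> b /andP[/eqP nb /orP[] /eqP e]; exists b; split=> //; by [left|right].
Qed.

Lemma single_src a b : ~~ nsingle a -> src b = src a -> b = a.
Proof.
move=> sa e; apply/eqP; apply: contraNT sa => nb.
by apply/existsP; exists b; rewrite nb e eqxx.
Qed.

Lemma single_tgt a b : ~~ nsingle a -> tgt b = tgt a -> b = a.
Proof.
move=> sa e; apply/eqP; apply: contraNT sa => nb.
by apply/existsP; exists b; rewrite nb e eqxx orbT.
Qed.

(** Stated for lists of arrows: a non-empty list determines the starting vertex of
    the path, which is therefore left implicit. *)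
Definition survives s : Prop :=
  exists v (h : composable v s), ~ I (elt (@QPath Q (v, s) h)).

Let I_ideal : ideal I. Proof. by case: hI => -[]. Qed.

Lemma path_elt_cat v s t (h : composable v (s ++ t)) :
  exists w (h1 : composable v s) (h2 : composable w t),
    elt (@QPath Q (v, s ++ t) h) = elt (@QPath Q (w, t) h2) * elt (@QPath Q (v, s) h1).
Proof.
have [h1 h2] : composable v s /\ composable (last v (map (@tgt Q) s)) t.
  by move: h; rewrite composable_cat => /andP.
exists (last v (map (@tgt Q) s)), h1, h2.
rewrite path_eltM; case: path_compP => [r _ e1 _ e2|] //=.
by congr (elt _); apply: qpath_eq; rewrite ?e1 ?e2.
Qed.

Lemma survives_catl s t : survives (s ++ t) -> survives s.
Proof.
move=> [v [h nI]]; have [w [h1 [h2 e]]] := path_elt_cat h.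
exists v, h1 => Is; apply: nI; rewrite e.
by have [_ _ M] := I_ideal; case: (M (elt (@QPath Q (w, t) h2)) _ Is).
Qed.

Lemma survives_catr s t : survives (s ++ t) -> survives t.
Proof.
move=> [v [h nI]]; have [w [h1 [h2 e]]] := path_elt_cat h.
exists w, h2 => It; apply: nI; rewrite e.
by have [_ _ M] := I_ideal; case: (M (elt (@QPath Q (v, s) h1)) _ It).
Qed.

Lemma survives_composable a s : survives (a :: s) -> composable (tgt a) s.
Proof. by case=> v [h _]; case/andP: h. Qed.

Lemma contains_nsingle v s (h : composable v s) :
  has nsingle s -> contains_non_single (@QPath Q (v, s) h).
Proof. by case/hasP=> a ap na; exists a => //; apply: nsingleP. Qed.

Lemma survives_rcons_inj s b b' : has nsingle s ->
  survives (rcons s b) -> survives (rcons s b') -> b = b'.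
Proof.
case: s => // a s ns [v [h nI]] [v' [h' nI']].
have ev : src a = v by case/andP: (h) => /eqP.
have ev' : src a = v' by case/andP: (h') => /eqP.
subst v v'; move: nI nI'.
have [g ->] := path_elt_rcons k h; have [g' ->] := path_elt_rcons k h'.
rewrite (bool_irrelevance g' g).
have [_ _ ue] := hI; have [H _] := ue _ (contains_nsingle g ns).
exact: H.
Qed.

Lemma survives_cons_inj s c c' : has nsingle s ->
  survives (c :: s) -> survives (c' :: s) -> c = c'.
Proof.
case: s => // a s ns [v [h nI]] [v' [h' nI']].
have [w [h1 [h2 e]]] := @path_elt_cat v [:: c] (a :: s) h.
have [w' [h1' [h2' e']]] := @path_elt_cat v' [:: c'] (a :: s) h'.
have ew : src a = w by case/andP: (h2) => /eqP.
have ew' : src a = w' by case/andP: (h2') => /eqP.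
subst w w'; rewrite (bool_irrelevance h2' h2) in e'.
have ec d u (g : composable u [:: d]) : @QPath Q (u, [:: d]) g = parrow d.
  by apply: qpath_eq => //; case/andP: (g) => /eqP.
rewrite ec in e; rewrite ec in e'.
have [_ _ ue] := hI; have [_ H] := ue _ (contains_nsingle h2 ns).
by apply: H => J; [apply: nI; rewrite -e in J|apply: nI'; rewrite -e' in J].
Qed.

(** The paths in question run from the non-single arrow c to the next non-single
    arrow b; along the single arrows between them the lane is not visible. *)
Definition linked c b : Prop := exists P,
  [/\ all (predC nsingle) P, nsingle c, nsingle b & survives (c :: rcons P b)].

(** A single arrow is the only arrow ending at its target, so a path of single
    arrows can be retraced from its end in one way only; the retracing stops
    exactly at a vertex where a non-single arrow ends. *)
Lemma single_path_back P P' c c' :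
  all (predC nsingle) P -> all (predC nsingle) P' -> nsingle c -> nsingle c' ->
  composable (tgt c) P -> composable (tgt c') P' ->
  last (tgt c) (map (@tgt Q) P) = last (tgt c') (map (@tgt Q) P') ->
  P = P' /\ tgt c = tgt c'.
Proof.
move=> + + nc nc'; elim/last_ind: P P' => [|P a IH] P'; case/lastP: P' => [|P' a'] //=.
- rewrite all_rcons map_rcons last_rcons => _ /andP[sa _] _ _ e.
  by rewrite (single_tgt sa e) in nc; case/negP: sa.
- rewrite all_rcons map_rcons last_rcons => /andP[sa _] _ _ _ e.
  by rewrite (single_tgt sa (esym e)) in nc'; case/negP: sa.
rewrite !all_rcons !map_rcons !last_rcons => /andP[sa sP] /andP[sa' sP'].
rewrite -!cats1 !composable_cat /= !andbT => /andP[cP /eqP ea] /andP[cP' /eqP ea'].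
move=> /(single_tgt sa') eaa; subst a'.
by have [|-> ->] := IH P' sP sP' cP cP'; first by rewrite -ea.
Qed.

Lemma linked_same_path c b c' b' : linked c b -> linked c' b' -> src b = src b' ->
  exists P, [/\ survives (c :: rcons P b), survives (c' :: rcons P b') & tgt c = tgt c'].
Proof.
move=> [P [sP nc _ hP]] [P' [sP' nc' _ hP']] e.
have := survives_composable hP; have := survives_composable hP'.
rewrite -!cats1 !composable_cat /= !andbT => /andP[cP' /eqP eb'] /andP[cP /eqP eb].
have [eP ec] : P = P' /\ tgt c = tgt c'.
  by apply: single_path_back; rewrite // -eb -eb'.
by exists P; rewrite {2}eP.
Qed.

(** Both links use the same path P, so c and c' extend the path b P at its start,
    and this path contains the non-single arrow b. *)
Lemma linked_inj c c' b : linked c b -> linked c' b -> c = c'.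
Proof.
move=> l l'; have [P [h h' _]] := linked_same_path l l' erefl.
apply: (survives_cons_inj _ h h').
by rewrite has_rcons; case: l => ? [_ _ ->].
Qed.

Lemma linked_src_inj c b b' : linked c b -> linked c b' -> src b = src b' -> b = b'.
Proof.
move=> l l' e; have [P [h h' _]] := linked_same_path l l' e.
apply: (survives_rcons_inj _ (s := c :: P) h h').
by case: l => ? [_ /= ->].
Qed.

(** [cin a] and [cout a] are the bits of the lane on which a non-single arrow a
    reaches its target and leaves its source.  After [cin] is fixed, the links give
    a partial colouring of the arrows by source, which is extended. *)
Lemma colouring_exists : exists cin cout : arrow Q -> bool,
  [/\ forall a b, tgt a = tgt b -> cin a = cin b -> a = b,
      forall a b, src a = src b -> cout a = cout b -> a = b
    & forall c b, linked c b -> cout b = cin c].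
Proof.
have [_ two _] := hI.
have [cin [cinP _]] := @extend_two_colouring _ _ (@tgt Q) (fun v => (two v).2)
  (fun=> None) (fun _ _ _ _ => ltac:(by [])).
pose h b := if pselect (exists c, linked c b) is left e
  then Some (cin (projT1 (cid e))) else None.
have hE b i : h b = Some i -> exists2 c, linked c b & cin c = i.
  rewrite /h; case: pselect => // e [<-].
  by exists (projT1 (cid e)) => //; apply: (projT2 (cid e)).
have [|cout [coutP coutE]] := @extend_two_colouring _ _ (@src Q) (fun v => (two v).1) h.
  move=> a b i e /hE[c lc ec] /hE[d ld ed].
  have [P [_ _ et]] := linked_same_path lc ld e.
  have ecd : c = d by apply: cinP => //; rewrite ec ed.
  by subst d; apply: linked_src_inj lc ld e.
exists cin, cout; split=> // c b l; apply: coutE.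
rewrite /h; case: pselect => [e|[]]; last by exists c.
by congr (Some (cin _)); apply: linked_inj (projT2 (cid e)) l.
Qed.

Section Lanes.
Variables cin cout : arrow Q -> bool.
Hypothesis cin_inj : forall a b, tgt a = tgt b -> cin a = cin b -> a = b.
Hypothesis cout_inj : forall a b, src a = src b -> cout a = cout b -> a = b.
Hypothesis linkedE : forall c b, linked c b -> cout b = cin c.

(** A single arrow can be entered on either lane and keeps the bit; a non-single
    arrow is entered on the lane [cout a] and left on the lane [cin a]. *)
Definition enters i a := nsingle a ==> (cout a == i).
Definition leaves i a := if nsingle a then cin a else i.

Fixpoint on_lane i s : bool :=
  if s is a :: s' then enters i a && on_lane (leaves i a) s' else true.

Lemma on_lane_single i P t : all (predC nsingle) P -> on_lane i (P ++ t) = on_lane i t.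
Proof.
elim: P => //= a P IH /andP[/negPf sa /IH <-].
by rewrite /enters /leaves sa.
Qed.

(** Induction from the front.  When a non-single arrow a is put before s, the lane on
    which s starts must be [cin a].  If all arrows of s are single, s can be followed
    on any lane; otherwise that lane is [cout b] for the first non-single arrow b of
    s, and a is linked to b. *)
Lemma survives_on_lane s : survives s -> exists i, on_lane i s.
Proof.
elim: s => [|a s IH] hs; first by exists true.
have [i hi] : exists i, on_lane i s by apply: IH; apply: (@survives_catr [:: a]).
have [na|/negPf sa] := boolP (nsingle a); last first.
  by exists i => /=; rewrite /enters /leaves sa hi.
exists (cout a) => /=; rewrite /enters /leaves na eqxx /=.
have [hns|] := boolP (has nsingle s); last first.
  rewrite -all_predC => sing; by rewrite -[s]cats0 on_lane_single.
move: hs hi; case: (split_find hns) => b P t nb; rewrite -all_predC => sP hs.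
rewrite cat_rcons !on_lane_single //= /enters nb /= => /andP[_].
have lab : linked a b.
  by exists P; split=> //; apply: (@survives_catl (a :: rcons P b) t).
by rewrite (linkedE lab) eqxx /leaves nb.
Qed.

Definition out_arrow (x : lane) : option (arrow Q) :=
  [pick a | (src a == x.1) && enters x.2 a].

(** A lane cannot choose between two arrows: distinct arrows with a common source
    are both non-single and have different [cout]. *)
Lemma out_arrowE x a : src a = x.1 -> enters x.2 a -> out_arrow x = Some a.
Proof.
move=> sa ea; rewrite /out_arrow; case: pickP => [b /andP[/eqP sb eb]|/(_ a)]; last first.
  by rewrite sa eqxx ea.
congr Some; have e : src b = src a by rewrite sb.
have [na|/single_src H] := boolP (nsingle a); last exact: H.
have [nb|/single_src H] := boolP (nsingle b); last by rewrite (H a).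
move: ea eb; rewrite /enters na nb /= => /eqP ea /eqP eb.
by apply: cout_inj => //; rewrite ea eb.
Qed.

Lemma out_arrowP x a : out_arrow x = Some a -> src a = x.1 /\ enters x.2 a.
Proof.
by rewrite /out_arrow; case: pickP => // b /andP[/eqP sb eb] [<-].
Qed.

Definition next_lane (x : lane) : lane :=
  if out_arrow x is Some a then (tgt a, leaves x.2 a) else x.

(** Two arrows entering the same lane have a common target, so distinct ones would
    both be non-single and differ in [cin]. *)
Lemma next_lane_inj : {in [set x | out_arrow x] &, injective next_lane}.
Proof.
move=> x y; rewrite !inE /next_lane.
case ex: (out_arrow x) => [a|] // _; case ey: (out_arrow y) => [b|] // _ [et el].
have [sa ea] := out_arrowP ex; have [sb eb] := out_arrowP ey.
have eab : a = b.
  have [na|/single_tgt H] := boolP (nsingle a); last by rewrite (H b).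
  have [nb|/single_tgt H] := boolP (nsingle b); last exact: H.
  by apply: cin_inj => //; move: el; rewrite /leaves na nb.
subst b; apply/eqP; rewrite -pair_eqE /= -sa -sb eqxx /=; apply/eqP.
move: ea eb el; rewrite /enters /leaves.
by case: (nsingle a) => //= /eqP-> /eqP->.
Qed.

End Lanes.

Definition add_arrows (D : finType) (f g : D -> vertex Q) : quiver :=
  @Quiver (vertex Q) (arrow Q + D)%type
    (fun u => match u with inl a => src a | inr d => f d end)
    (fun u => match u with inl a => tgt a | inr d => g d end).

(** The new arrows are indexed by the lanes without an outgoing arrow.  Completing
    the partial injection to a permutation supplies the target of each. *)
Lemma lane_completion : exists (D : finType) (f g : D -> vertex Q)
    (S : lane_system (add_arrows f g)),
  forall p : qpath Q, ~ I (elt p) -> exists x : vertex Q * bool,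
    psrc p = x.1 /\ map inl (parrows p) = walk S x (plen p).
Proof.
have [cin [cout [cin_inj cout_inj linkedE]]] := colouring_exists.
have [next [next_inj nextE]] := extend_injection (next_lane_inj cin_inj (cout := cout)).
pose out := out_arrow cout.
pose D : finType := {x : lane | ~~ isSome (out x)}.
pose Q' := add_arrows (fun d : D => (val d).1) (fun d : D => (next (val d)).1).
exists D, (fun d => (val d).1), (fun d => (next (val d)).1); rewrite -/Q'.
have nextS x a : out x = Some a -> next x = (tgt a, leaves cin x.2 a).
  by move=> e; rewrite nextE ?inE /next_lane -/(out x) e.
have /choice[label labelP] : forall x, exists u : arrow Q',
    [/\ src u = x.1, tgt u = (next x).1, forall a, out x = Some a -> u = inl a
      & forall d : D, val d = x -> u = inr d].
  move=> x; case e: (out x) => [a|].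
    exists (inl a); split=> /=; last by move=> d ed; have := valP d; rewrite /= ed e.
    - by have [] := out_arrowP e.
    - by rewrite (nextS _ _ e).
    - by move=> b [->].
  have dx : ~~ isSome (out x) by rewrite e.
  exists (inr (Sub x dx)); split=> //= d ed; congr inr.
  by apply: val_inj.
have labelS x a : src a = x.1 -> enters cout x.2 a -> label x = inl a.
  move=> sa ea; have [_ _ H _] := labelP x.
  exact: H (out_arrowE cout_inj sa ea).
have src_label x : @src Q' (label x) = x.1 by case: (labelP x).
have tgt_label x : @tgt Q' (label x) = (next x).1 by case: (labelP x).
have label_surj (u : arrow Q') : exists x, label x = u.
  case: u => [a|d]; last by exists (val d); case: (labelP (val d)) => _ _ _; apply.
  by exists (src a, cout a); apply: labelS => //; rewrite /enters eqxx implybT.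
exists (@LaneSystem Q' next label next_inj src_label tgt_label label_surj).
case=> [[v s] h]; rewrite /psrc /parrows /plen /= => nI.
have [i hi] : exists i, on_lane cin cout i s.
  by apply: (survives_on_lane linkedE); exists v, h.
exists (v, i); split=> //.
elim: s v i {nI} h hi => //= a s IH v i /andP[/eqP sa h] /andP[ea hi].
rewrite /walk /= (labelS (v, i) a sa ea); congr cons.
rewrite (nextS (v, i) a); last exact: (@out_arrowE _ cout_inj (v, i)).
exact: IH.
Qed.

End LanesOfPair.

(** * The surjection onto the given algebra *)

Lemma morita_refl (k : fieldType) (A : algType k) : morita_equivalent A A.
Proof.
pose F := @ModFunctor k A A id (fun _ _ => id) (fun _ _ _ _ e => e)
  (fun _ _ => erefl) (fun _ _ _ _ _ _ => erefl) (fun _ _ _ _ _ _ e => e).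
exists F, F, (fun M => idfun : {linear M -> M}), (fun M => idfun : {linear M -> M}).
by split=> // M; exists idfun.
Qed.

Section Collapse.
Variables (k : fieldType) (Q : quiver) (I : path_algebra k Q -> Prop) (A : algType k).
Variable pi : {linear path_algebra k Q -> A}.
Hypothesis pi_mor : monoid_morphism pi.
Hypothesis pi_ker : forall x, pi x = 0 <-> I x.
Variables (D : finType) (f g : D -> vertex Q).
Local Notation Q' := (add_arrows f g).
Local Notation elt p := (path_elt k p).

Definition collapse_vertex (v : vertex Q') : A := pi (elt (@ptriv Q v)).
Definition collapse_arrow (u : arrow Q') : A :=
  if u is inl a then pi (elt (parrow a)) else 0.

Lemma collapse_vertex_orth v w :
  collapse_vertex v * collapse_vertex w = if v == w then collapse_vertex v else 0.
Proof.
have [_ piM] := pi_mor; rewrite /collapse_vertex -piM path_eltM path_comp1p.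
by rewrite /ptgt /=; case: eqP => [->|_] //=; rewrite linear0.
Qed.

Lemma collapse_vertex_sum : \sum_v collapse_vertex v = 1.
Proof.
by have [pi1 _] := pi_mor; rewrite -pi1 path_algebra1 linear_sum.
Qed.

Lemma collapse_arrow_tgt u : collapse_vertex (tgt u) * collapse_arrow u = collapse_arrow u.
Proof.
case: u => [a|d]; last by rewrite mulr0.
have [_ piM] := pi_mor; rewrite /collapse_vertex /= -piM path_eltM path_comp1p.
by rewrite /ptgt /= eqxx.
Qed.

(** The homomorphism that restricts to [pi] on the paths of Q and kills the added
    arrows. *)
Definition collapse : path_algebra k Q' -> A := path_lift collapse_vertex collapse_arrow.
HB.instance Definition _ := GRing.Linear.on collapse.

Local Notation collapse_val := (path_val collapse_vertex collapse_arrow).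

Lemma composable_inl (v : vertex Q) s : @composable Q' v (map inl s) = composable v s.
Proof. by elim: s v => //= a s IH v; rewrite IH. Qed.

Lemma collapse_val_inl (v : vertex Q) s (h : composable v s) (h' : @composable Q' v (map inl s)) :
  collapse_val (@QPath Q' (v, map inl s) h') = pi (elt (@QPath Q (v, s) h)).
Proof.
rewrite /path_val /psrc /parrows /= {h'}; elim/last_ind: s h => [|s a IH] h.
  by congr (pi (elt _)); apply: qpath_eq.
have [h' ->] := path_elt_rcons k h; have [_ piM] := pi_mor.
by rewrite map_rcons foldl_rcons (IH h') piM.
Qed.

Lemma collapse_valP (p : qpath Q') : collapse_val p = 0 \/
  exists q : qpath Q, [/\ psrc p = psrc q, parrows p = map inl (parrows q)
    & collapse_val p = pi (elt q)].
Proof.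
case: p => [[v s] h]; have [[t est]|] : (exists t, s = map inl t) \/
    foldl (fun b u => collapse_arrow u * b) (collapse_vertex v) s = 0.
- elim/last_ind: s {h} => [|s [a|d] [[t ->]|e0]]; first by left; exists [::].
  + by left; exists (rcons t a); rewrite map_rcons.
  + by right; rewrite foldl_rcons e0 mulr0.
  + by right; rewrite foldl_rcons mul0r.
  + by right; rewrite foldl_rcons mul0r.
- subst s; have h' : @composable Q v t by rewrite -composable_inl.
  by right; exists (@QPath Q (v, t) h'); rewrite (collapse_val_inl h').
by left.
Qed.

(** Every path of Q' has value 0 in A, except the paths of Q outside I.  The latter
    are segments of lanes, of length below m, so they do not occur in elements of
    the radical. *)
Lemma collapse_radical (S : lane_system Q') (L N m : nat) :
  (forall p : qpath Q, ~ I (elt p) -> exists x : vertex Q * bool,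
    psrc p = x.1 /\ map inl (parrows p) = walk S x (plen p)) ->
  (forall p : qpath Q, (m <= plen p)%N -> I (elt p)) ->
  (0 < L)%N -> (forall x, iter L (next S) x = x) ->
  (forall x, iter N (next S) x = x) -> (m + L <= N)%N ->
  forall u, trace_radical (k := k) S N u -> collapse u = 0.
Proof.
move=> hS hm L0 iterL iterN mLN u hu.
rewrite /collapse /path_lift /lin_ext big1_seq // => p _.
case: (collapse_valP p) => [->|[q [ev es ->]]]; first by rewrite scaler0.
have [/pi_ker->|nI] := pselect (I (elt q)); first by rewrite scaler0.
have [x [exv exs]] := hS q nI.
have -> : p = seg S x (plen q).
  by apply: qpath_eq; rewrite ?ev ?es.
rewrite (radical_coeff L0 iterL iterN _ hu) ?scale0r //.
apply: leq_trans mLN; rewrite leq_add2r leqNgt; apply/negP => lt.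
by apply: nI; apply: hm; apply: ltnW.
Qed.

End Collapse.

Theorem theorem0p1 (k : fieldType) (Q : quiver) (I : path_algebra k Q -> Prop)
    (A : algType k)
    (hI : special_quasi_biserial_pair I) (hA : is_path_quotient I A) :
  exists As : falgType k,
    [/\ special_quasi_biserial As, symmetric_algebra As
      & exists f : {lrmorphism As -> A}, forall a : A, exists x : As, f x = a].
Proof.
have [pi [pi_mor pi_surj pi_ker]] := hA; have [pi1 piM] := pi_mor.
have [D [f [g [S hS]]]] := lane_completion hI.
have [L L0 iterL] := injection_period (@next_inj _ S).
have [[_ [m _ [hm _]]] _ _] := hI.
have longI (p : qpath Q) : (m <= plen p)%N -> I (path_elt k p).
  by move=> mp; apply/hm/deg_arrow_ideal_exp/deg_ge_path.
(* [m.+2] periods leave room for a full period after any path of length at most m,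
   and make N larger than L. *)
pose N := (m.+2 * L)%N.
have iterN x : iter N (next S) x = x.
  by rewrite /N; elim: m.+2 => // n IH; rewrite mulSn iterD IH iterL.
have mLN : (m + L <= N)%N.
  by rewrite /N mulSn addnC leq_add2l (leq_trans (leqnSn m)) // leq_pmulr.
have ltLN : (L < N)%N by rewrite /N ltn_Pmull.
(* A is not the zero ring, so Q has a vertex. *)
have v0 : inhabited (vertex Q).
  have [[v]|nv] := pselect (inhabited (vertex Q)); first by constructor.
  have := oner_neq0 A; rewrite -pi1 path_algebra1 big1 ?linear0 ?eqxx // => v.
  by case: nv.
have [As [rho [rho_mor rho_surj rho_ker As_sym]]] :=
  lane_symmetric_algebra k iterN v0.
have [rho1 rhoM] := rho_mor.
exists As; split=> //.
  exists (add_arrows f g), (trace_radical S N), As; split; last exact: morita_refl.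
    exact: lane_special_quasi_biserial L0 iterL ltLN iterN.
  by exists rho.
pose phi : {linear path_algebra k (add_arrows f g) -> A} := @collapse k Q A pi D f g.
have phiM x y : phi (x * y) = phi x * phi y.
  apply: path_liftM; [exact: collapse_vertex_orth|exact: collapse_arrow_tgt].
have phi1 : phi 1 = 1 by apply: path_lift1; apply: collapse_vertex_sum.
have /choice[rep repK] := rho_surj.
have phiE x : phi (rep (rho x)) = phi x.
  apply/eqP; rewrite -subr_eq0 -linearB; apply/eqP.
  apply: (collapse_radical pi_mor pi_ker hS longI L0 iterL iterN mLN).
  by apply/rho_ker; rewrite linearB repK subrr.
pose h b := phi (rep b).
have h_lin : linear h.
  by move=> c b1 b2; rewrite /h -{1}(repK b1) -{1}(repK b2) -linearP phiE linearP.
have h_mon : monoid_morphism h.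
  split=> [|b1 b2]; first by rewrite /h -rho1 phiE phi1.
  by rewrite /h -{1}(repK b1) -{1}(repK b2) -rhoM phiE phiM.
pose hL := GRing.isLinear.Build k As A *:%R h h_lin.
pose hM := GRing.isMonoidMorphism.Build As A h h_mon.
pose F : {lrmorphism As -> A} := HB.pack h hL hM.
exists F => a; have [x <-] := pi_surj a.
have FE u : F (rho u) = phi u by apply: phiE.
elim/path_algebra_ind: x => [|c x y [u hu] [w hw]|[[v s] q]].
- by exists 0; rewrite !linear0.
- by exists (c *: u + w); rewrite !linearP -hu -hw.
have q' : @composable (add_arrows f g) v (map inl s) by rewrite composable_inl.
exists (rho (path_elt k (@QPath (add_arrows f g) (v, map inl s) q'))).
by rewrite FE; apply: etrans (path_lift_elt _ _ _) (collapse_val_inl pi_mor q q').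
Qed.
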